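(* Let $G$ be a finite group of order greater than $1$, let $q$ be the smallest prime divisor of $|G|$, and let $Q\in{\rm Syl}_q(G)$. Then ${\rm mf}_{pp}(G)\leq q$ if and only if $G$ is one of the following groups: (1) $G=Q\times R$, where $R\geq 1$ is a cyclic Hall $q'$-subgroup of $G$, and $Q$ is one of: $Q\cong Z_{q^m}$ with $m\geq 1$; or $Q\cong Z_{q^{m-1}}\times Z_q$ with $m\geq 2$; or $Q\cong Q_8$ (quaternion group of order $8$); or $Q\cong\langle a, b\mid a^{2^{m-1}}=b^2=1,\ b^{-1}ab=a^{1+2^{m-2}}\rangle$ with $m\geq 4$ (here $q=2$); or $Q\cong\langle a, b\mid a^{q^{m-1}}=b^q=1,\ b^{-1}ab=a^{1+q^{m-2}}\rangle$ with $q>2$ and $m\geq 3$. (2) $G\cong\langle a,b\mid a^{2^m}=b^3=1,\ a^{-1}ba=b^{-1}\rangle\times T$, where $m\geq 1$, $T$ is cyclic and $\gcd(|T|,6)=1$.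
   Context: All groups are finite. For a group $G$ and a positive integer $n$ dividing $|G|$, let $F_n(G)=\{g\in G\mid g^n=1\}$. By Frobenius' theorem $|F_n(G)|=f_n\cdot n$ for a positive integer $f_n$, called the Frobenius quotient of $G$ for $n$. ${\rm exp}(G)$ denotes the exponent of $G$. A prime-power divisor of ${\rm exp}(G)$ is a positive divisor $n$ of ${\rm exp}(G)$ of the form $n=p^k$ with $p$ prime and $k\geq 0$ (so $n=1$ is included). $\mathcal{F}_{pp}(G)=\{f_n\mid n \text{ is a prime-power divisor of } {\rm exp}(G)\}$ and ${\rm mf}_{pp}(G)$ is the maximum element of $\mathcal{F}_{pp}(G)$. *)

(* Defs.v *)
From mathcomp Require Import all_boot all_fingroup all_solvable.
Set Implicit Arguments. Unset Strict Implicit. Unset Printing Implicit Defensive.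
Local Open Scope group_scope.

Definition Fset (gT : finGroupType) (G : {set gT}) (n : nat) : {set gT} :=
  [set g in G | g ^+ n == 1].

(* Frobenius quotient f_n = |F_n(G)| / n (exact division by Frobenius' theorem) *)
Definition frob_quot (gT : finGroupType) (G : {set gT}) (n : nat) : nat :=
  #|Fset G n| %/ n.

(* n is a prime power p^k with p prime and k >= 0 (so n = 1 counts);
   the bounds p <= n+1, k <= n lose nothing for n >= 1. *)
Definition is_ppow (n : nat) : bool :=
  [exists p : 'I_n.+2, exists k : 'I_n.+1, prime p && (n == p ^ k)%N].

Definition mf_pp (gT : finGroupType) (G : {set gT}) : nat :=
  \max_(n < (exponent G).+1 | (n %| exponent G)%N && is_ppow n) frob_quot G n.

(* Main.v *)
Require Import Defs.
From mathcomp Require Import all_boot all_fingroup all_solvable zify.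
Set Implicit Arguments. Unset Strict Implicit. Unset Printing Implicit Defensive.
Local Open Scope group_scope.

(* Elements of order p^(k+1) come in packets of p^k (p - 1), so every Frobenius
   quotient for a power of p is congruent to 1 modulo p - 1.  For p > q a bound
   by q < p therefore forces all these quotients to be 1, which makes the Sylow
   p-subgroup cyclic and normal; hence G has a normal cyclic Hall q'-subgroup R.
   Let q^e be the exponent of Q, so that |Q| is q^e or q^(e+1).
   If |Q| = q^(e+1), then Q is the full solution set of x^(q^e) = 1, hence it is
   normal and G = Q x R; moreover Q has a cyclic maximal subgroup, and counting
   solutions of x^2 = 1 and x^4 = 1 discards the dihedral, semidihedral and large
   quaternion groups from the known list.
   If Q is cyclic and not normal, its s > 1 conjugates have pairwise disjoint sets
   of generators, so s (q - 1) < q^2; as all prime divisors of s exceed q this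
   gives q = 2 and s = 3, and then [R, Q] has order 3 and is inverted by Q. *)

(** * Solution sets of x^n = 1 and counts of elements by order *)

Lemma Ldiv1 (gT : finGroupType) (G : {group gT}) : 'Ldiv_1(G) = [1 gT].
Proof.
apply/setP=> x; rewrite !inE expg1; apply: andb_idl => /eqP->; exact: group1.
Qed.

(** [frob_quot] is a floor division, and floor(a / n) <= q amounts to a < (q + 1) n; this removes
    division from everything that follows. *)
Lemma mf_pp_leP (gT : finGroupType) (G : {group gT}) q :
  (mf_pp G <= q)%N <->
  (forall p k, prime p -> p ^ k %| exponent G ->
     #|'Ldiv_(p ^ k)(G)| < q.+1 * p ^ k)%N.
Proof.
have LdivE n : Fset G n = 'Ldiv_n(G) by apply/setP=> x; rewrite !inE.
split=> [/bigmax_leqP mf_le p k p_pr dv_pk | Ldiv_lt].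
  have pk_gt0 : (0 < p ^ k)%N by rewrite expn_gt0 prime_gt0.
  have lt_pk : (p ^ k < (exponent G).+1)%N.
    by rewrite ltnS dvdn_leq ?exponent_gt0.
  have := mf_le (Ordinal lt_pk); rewrite /frob_quot LdivE /= dv_pk /=.
  rewrite -ltnS ltn_divLR //; apply.
  case: k {dv_pk lt_pk} pk_gt0 => [|k] pk_gt0.
    by apply/existsP; exists (@Ordinal 3 2 isT); apply/existsP; exists ord0.
  have p_lt : (p < (p ^ k.+1).+2)%N.
    by rewrite ltnW // !ltnS expnS leq_pmulr // expn_gt0 prime_gt0.
  have k_lt : (k.+1 < (p ^ k.+1).+1)%N by rewrite ltnW // ltnS ltn_expl ?prime_gt1.
  apply/existsP; exists (Ordinal p_lt); apply/existsP; exists (Ordinal k_lt).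
  by rewrite /= p_pr eqxx.
apply/bigmax_leqP=> n /andP[dv_n /existsP[p /existsP[k /andP[p_pr /eqP def_n]]]].
rewrite /frob_quot LdivE def_n -ltnS ltn_divLR ?expn_gt0 ?prime_gt0 //.
by apply: Ldiv_lt => //; rewrite -def_n.
Qed.

(** Each x generates exactly one cyclic subgroup, and C has [totient #|C|] generators. Applied below
    to the cyclic subgroups of a given order and to the Sylow q-subgroups. *)
Lemma card_cycle_in (gT : finGroupType) (A : {set {group gT}}) :
    {in A, forall C : {group gT}, cyclic C} ->
  #|[set x | <[x]>%G \in A]| = (\sum_(C in A) totient #|C|)%N.
Proof.
move=> cycA; rewrite -sum1_card.
rewrite (partition_big (fun x : gT => <[x]>%G) (mem A)) => [|x]; last by rewrite inE.
apply: eq_bigr => C AC; have /cyclicP[a defC] := cycA C AC.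
rewrite sum1_card defC -/#[a] totient_gen; apply: eq_card => x; rewrite !inE.
rewrite /generator -defC unfold_in /= inE; apply/andP/eqP => [[_ /eqP <-] //| eqCx].
by have -> : <[x]>%G = C by apply: val_inj; rewrite /= -eqCx.
Qed.

Lemma totient_dvd_card_order (gT : finGroupType) (G : {group gT}) n :
  totient n %| #|[set x in G | #[x] == n]|.
Proof.
pose A := [set C : {group gT} | [&& C \subset G, cyclic C & #|C| == n]].
have -> : [set x in G | #[x] == n] = [set x | <[x]>%G \in A].
  by apply/setP=> x; rewrite !inE /= cycle_subG cycle_cyclic.
rewrite card_cycle_in => [|C]; last by rewrite inE => /and3P[].
by apply: dvdn_sum => C; rewrite inE => /and3P[_ _ /eqP->].
Qed.

Lemma card_LdivS (gT : finGroupType) (G : {group gT}) p k : prime p ->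
  #|'Ldiv_(p ^ k.+1)(G)| =
    (#|'Ldiv_(p ^ k)(G)| + #|[set x in G | #[x] == p ^ k.+1]|)%N.
Proof.
move=> p_pr; rewrite -(cardsID 'Ldiv_(p ^ k)()); congr (_ + _)%N; apply: eq_card => x.
  rewrite !inE -!order_dvdn; case: (x \in G) => //=.
  by apply/andP/idP => [[]|dv_x] //; split=> //; apply: dvdn_trans dv_x (dvdn_exp2l _ _).
rewrite !inE -!order_dvdn; case: (x \in G) => //=; rewrite ?andbF //.
apply/andP/eqP => [[ndv /(dvdn_pfactor _ _ p_pr)[i le_i ox]]| ->].
  rewrite ox (dvdn_Pexp2l _ _ (prime_gt1 p_pr)) -ltnNge in ndv.
  by rewrite ox; congr (_ ^ _)%N; apply/eqP; rewrite eqn_leq le_i.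
by rewrite dvdnn (dvdn_Pexp2l _ _ (prime_gt1 p_pr)) ltnn.
Qed.

(** * Quotients below p give cyclic normal Sylow p-subgroups *)

Lemma dvdn_exponent_card (gT : finGroupType) (G : {group gT}) n :
  n %| exponent G -> n %| #|G|.
Proof. by move/dvdn_trans; apply; apply: exponent_dvdn. Qed.

(** Induction on k: by Frobenius the count is f p^(k+1), and it is also p^k plus c p^k (p - 1)
    elements of order p^(k+1). Hence f p = 1 + c (p - 1), and f < p leaves f = 1. *)
Lemma card_Ldiv_small_quotient (gT : finGroupType) (G : {group gT}) p k :
    prime p ->
    (forall i, (i <= k)%N -> #|'Ldiv_(p ^ i)(G)| < p * p ^ i)%N ->
    p ^ k %| exponent G ->
  #|'Ldiv_(p ^ k)(G)| = (p ^ k)%N.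
Proof.
move=> p_pr; elim: k => [|k IHk] Ldiv_lt dv_pk; first by rewrite Ldiv1 cards1.
have pk_gt0 : (0 < p ^ k)%N by rewrite expn_gt0 prime_gt0.
have p_gt1 := prime_gt1 p_pr.
have IH : #|'Ldiv_(p ^ k)(G)| = (p ^ k)%N.
  apply: IHk => [i le_ik|]; first by apply: Ldiv_lt; apply: leqW.
  by apply: dvdn_trans dv_pk; apply: dvdn_exp2l.
have /dvdnP[f def_f] := Frobenius_Ldiv (dvdn_exponent_card dv_pk).
have := Ldiv_lt k.+1 (leqnn _); have := card_LdivS G k p_pr.
rewrite IH def_f ltn_pmul2r ?expn_gt0 ?prime_gt0 // => eq_f lt_fp.
have := totient_dvd_card_order G (p ^ k.+1); rewrite totient_pfactor //=.
case/dvdnP=> c def_c; rewrite {}def_c expnS in eq_f *.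
have {}eq_f : (f * p = 1 + c * p.-1)%N.
  by apply/eqP; rewrite -(eqn_pmul2r pk_gt0); apply/eqP; nia.
suff: (f = 1)%N by move=> ->; rewrite mul1n.
case: p p_gt1 lt_fp eq_f {p_pr Ldiv_lt IHk dv_pk pk_gt0 IH def_f} => //= P P_gt0 le_fP eq_f.
(* With P = p - 1 the equation reads f - 1 = (c - f) P, and 0 < f <= P forces c = f. *)
by case: (ltngtP c f) => [||def_c]; nia.
Qed.

(** P consists of solutions, so the count makes it the whole solution set, which is stable under
    conjugation. *)
Lemma normal_of_card_Ldiv (gT : finGroupType) (G P : {group gT}) n :
    P \subset G -> exponent P %| n -> (#|'Ldiv_n(G)| <= #|P|)%N ->
  P :=: 'Ldiv_n(G) /\ P <| G.
Proof.
move=> sPG expP le_P.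
have defP : P :=: 'Ldiv_n(G).
  by apply/eqP; rewrite eqEcard le_P andbT subsetI sPG sub_LdivT.
split=> //; rewrite /normal sPG; apply/normsP=> x Gx.
by rewrite defP -LdivJ conjGid.
Qed.

Lemma pgroup_exponent_witness (gT : finGroupType) (p : nat) (P : {group gT}) :
  p.-group P -> {x & {e | x \in P & #[x] = (p ^ e)%N /\ exponent P = (p ^ e)%N}}.
Proof.
move=> pP; have [x Px ox] := exponent_witness (pgroup_nil pP).
exists x; have /p_natP[e def_e] : p.-nat #[x] by apply: mem_p_elt pP Px.
by exists e; rewrite // ox.
Qed.

(** An element x of order p^e = exponent P already provides p^e solutions of x^(p^e) = 1, and there
    are no more; so <x>, P and the solution set coincide. *)
Lemma cyclic_normal_Sylow (gT : finGroupType) (G P : {group gT}) (p : nat) :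
    prime p ->
    (forall k, p ^ k %| exponent G -> #|'Ldiv_(p ^ k)(G)| < p * p ^ k)%N ->
    p.-Sylow(G) P ->
  cyclic P /\ P <| G.
Proof.
move=> p_pr Ldiv_lt sylP; have [sPG pP _] := and3P sylP.
have [x [e Px [ox expP]]] := pgroup_exponent_witness pP.
have dv_pe : p ^ e %| exponent G by rewrite -expP exponentS.
have oL : #|'Ldiv_(p ^ e)(G)| = (p ^ e)%N.
  apply: card_Ldiv_small_quotient => // i le_ie; apply: Ldiv_lt.
  by apply: dvdn_trans dv_pe; apply: dvdn_exp2l.
have sxP : <[x]> \subset P by rewrite cycle_subG.
have [||defP ->] := normal_of_card_Ldiv (n := p ^ e) sPG.
- by rewrite expP.
- by rewrite oL -ox subset_leq_card.
split=> //; apply/cyclicP; exists x; apply/eqP.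
by rewrite eq_sym eqEcard sxP -orderE ox defP oL /=.
Qed.

(** Normal Sylow subgroups lie in the Fitting subgroup, so its pi-core is the Hall subgroup; being
    nilpotent with cyclic Sylow subgroups, it is cyclic. *)
Lemma cyclic_normal_Hall (gT : finGroupType) (G : {group gT}) (pi : nat_pred) :
    (forall (p : nat) (P : {group gT}),
      prime p -> p \in pi -> p.-Sylow(G) P -> cyclic P /\ P <| G) ->
  exists R : {group gT}, [/\ pi.-Hall(G) R, cyclic R & R <| G].
Proof.
move=> sylG; exists 'O_pi('F(G))%G.
have nsRG : 'O_pi('F(G)) <| G by rewrite !gFnormal_trans.
have piR : pi.-group 'O_pi('F(G)) by apply: pcore_pgroup.
split=> //.
  rewrite pHallE (normal_sub nsRG) eqn_dvd -{1}(part_pnat_id piR).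
  rewrite partn_dvd ?cardG_gt0 ?cardSg ?normal_sub //=.
  apply/dvdn_partP=> [|p]; first exact: part_gt0.
  rewrite mem_primes => /and3P[p_pr _ dv_p].
  have pi_p : p \in pi.
    by apply: pnatPpi (part_pnat pi #|G|) _; rewrite mem_primes p_pr part_gt0.
  have [P sylP] := Sylow_exists p G; have [_ nsPG] := sylG p P p_pr pi_p sylP.
  have [sPG pP _] := and3P sylP.
  rewrite partn_part => [|i /eqP->//]; rewrite -(card_Hall sylP) cardSg //.
  have sPF : P \subset 'F(G) by rewrite Fitting_max ?(pgroup_nil pP).
  apply: pcore_max; first exact: pi_pnat pP pi_p.
  by apply: normalS nsPG; rewrite ?Fitting_sub.
apply: nil_Zgroup_cyclic; last by apply: nilpotentS (pcore_sub _ _) (Fitting_nil G).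
apply/forall_inP=> V /SylowP[p p_pr sylV].
have [pi_p | pi'p] := boolP (p \in pi).
  have [sVR pV _] := and3P sylV.
  have [P sylP sVP] := Sylow_superset (subset_trans sVR (normal_sub nsRG)) pV.
  by apply: cyclicS sVP _; have [] := sylG p P p_pr pi_p sylP.
suff -> : V :=: 1 by rewrite cyclic1.
apply/eqP; rewrite trivg_card1 (card_Hall sylV) part_p'nat //.
by apply: sub_in_pnat piR => r _ pi_r; apply: contraNneq pi'p => <-.
Qed.

(** * The case of a cyclic Sylow q-subgroup that is not normal *)

Lemma nonnormal_cyclic_Sylow (gT : finGroupType) (G Q : {group gT}) :
    let q := pdiv #|G| in (1 < #|G|)%N ->
    q.-Sylow(G) Q -> cyclic Q -> (#|'Ldiv_(#|Q|)(G)| <= q * #|Q|)%N -> ~~ (Q <| G) ->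
  q = 2 /\ #|G : 'N_G(Q)| = 3.
Proof.
move=> q G_gt1 sylQ cycQ le_L nnQ; have [sQG qQ _] := and3P sylQ.
have q_pr : prime q := pdiv_prime G_gt1; have q_gt1 := prime_gt1 q_pr.
have syl_sz (C : {group gT}) : C \in 'Syl_q(G) -> #|C| = #|Q|.
  by rewrite inE => /card_Hall->; rewrite (card_Hall sylQ).
have oS : #|[set x | <[x]>%G \in 'Syl_q(G)]| = (#|'Syl_q(G)| * totient #|Q|)%N.
  rewrite card_cycle_in => [|C sylC].
    by rewrite -sum_nat_const; apply: eq_bigr => C /syl_sz->.
  rewrite inE in sylC; have [y _ ->] := Sylow_trans sylQ sylC.
  by rewrite cyclicJ.
(* Generators of Sylow q-subgroups are solutions; strictness comes from 1, a solution that generates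
   no Sylow subgroup. *)
have {le_L} : (#|[set x | <[x]>%G \in 'Syl_q(G)]| < q * #|Q|)%N.
  apply: leq_trans le_L; apply: proper_card; apply/properP; split.
    apply/subsetP=> x; rewrite !inE => sylx.
    rewrite -cycle_subG (pHall_sub sylx) -order_dvdn orderE.
    by rewrite (_ : #|<[x]>| = #|Q|) ?dvdnn ?(syl_sz <[x]>%G) ?inE.
  exists 1; first by rewrite !inE group1 expg1n eqxx.
  rewrite !inE; apply/negP => syl1.
  have := syl_sz <[1]>%G; rewrite inE syl1 => /(_ isT) /esym/eqP.
  by rewrite -orderE order1 -trivg_card1 => /eqP Q1; rewrite Q1 normal1 in nnQ.
rewrite {}oS -(card_Syl sylQ); set s := #|'Syl_q(G)|.
have [e oQ] := p_natP qQ; have e_gt0 : (0 < e)%N.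
  by case: e oQ => // /eqP; rewrite -trivg_card1 => /eqP Q1; rewrite Q1 normal1 in nnQ.
rewrite oQ totient_pfactor // -(prednK e_gt0) expnS /=.
(* With |Q| = q^e, cancelling q^(e-1) leaves s (q - 1) < q^2. *)
rewrite [(q * (q * _))%N]mulnA [(s * _)%N]mulnA ltn_pmul2r ?expn_gt0 ?prime_gt0 //.
move=> lt_s; have s_mod := card_Syl_mod G q_pr; have s_dv := card_Syl_dvd q G.
rewrite -/s in s_mod s_dv.
have s_gt1 : (1 < s)%N.
  rewrite ltn_neqAle eq_sym -/s.
  have -> /= : s != 1%N.
    apply: contra nnQ => /normal_sylowP[P sylP nsP].
    have [y Gy ->] := Sylow_trans sylP sylQ.
    by rewrite (normsP (normal_norm nsP)).
  by case: (s) s_mod => //; rewrite mod0n.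
(* Prime divisors of s divide |G|, hence are at least q, and s = 1 mod q excludes q itself. *)
have q_le : (q < pdiv s)%N.
  rewrite ltn_neqAle pdiv_min_dvd ?prime_gt1 ?pdiv_prime //; last first.
    exact: dvdn_trans (pdiv_dvd s) s_dv.
  rewrite andbT.
  apply/eqP=> eq_q; have := pdiv_dvd s; rewrite -eq_q /dvdn s_mod //.
have s_le : (pdiv s <= s)%N by rewrite pdiv_leq // ltnW.
(* Already s >= q + 2 would give s (q - 1) >= q^2 + q - 2 >= q^2. *)
have def_s : (s = q.+1)%N.
  apply/eqP; rewrite eqn_leq (leq_trans q_le) // andbT leqNgt; apply/negP=> s_gt.
  case: (q) q_gt1 lt_s s_gt => //= q'; nia.
(* The least prime divisor of s is above q and at most s = q + 1, so s is prime; two consecutive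
   primes are 2 and 3. *)
have s_pr : prime q.+1.
  have -> : q.+1 = pdiv s by apply/eqP; rewrite eqn_leq q_le -def_s.
  exact: pdiv_prime.
suff q2 : q = 2 by rewrite def_s q2.
have [//|q_odd] := even_prime q_pr.
by have [q1|] := even_prime s_pr; [rewrite -q1 in q_gt1 *; lia | rewrite /= q_odd].
Qed.

(** The model [Extremal.gtype 3 (2 ^ m) 2] lets one generator act by y -> y^2, which is inversion in
    order 3. H satisfies the same relations and has the same order. *)
Lemma Grp_ext_dihedral3 m (gT : finGroupType) (H : {group gT}) x y :
    (0 < m)%N -> #|H| = (2 ^ m * 3)%N -> <[x]> <*> <[y]> = H ->
    x ^+ (2 ^ m) = 1 -> y ^+ 3 = 1 -> y ^ x = y^-1 ->
  H \isog Grp (a : b : (a ^+ (2 ^ m) = 1, b ^+ 3 = 1, b ^ a = b^-1)).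
Proof.
move=> m_gt0 oH defH x2m y3 yx.
have p_gt1 : (1 < 2 ^ m)%N by rewrite -{1}(expn0 2) ltn_exp2l.
have p_even : 2 %| 2 ^ m by rewrite dvdn_exp.
have isoED := @Grp_ext_dihedral 3 isT (2 ^ m) p_gt1 p_even.
have isoED' : [set: Extremal.gtype 3 (2 ^ m) 2]
    \isog Grp (a : b : (a ^+ (2 ^ m) = 1, b ^+ 3 = 1, b ^ a = b^-1)).
  move=> rT K; rewrite isoED.
  apply/existsP/existsP=> [[[a b]] | [[a b]]] /= /eqP[defK a1 b1 ab];
    by exists (b, a); rewrite /= joingC defK a1 b1 ab.
apply: isoGrp_trans (isoED'); apply/(isoGrpP _ isoED'); split.
  rewrite oH card_ext_dihedral // -divn2 -muln2.
  by rewrite -{1}(divnK p_even) -!mulnA.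
by apply/existsP; exists (x, y); rewrite /= defH x2m y3 yx.
Qed.

(** A centralises R / [R, A], and coprime action lifts fixed points, so C_R(A) covers this quotient;
    it meets [R, A] trivially because R is abelian. *)
Lemma coprime_abelian_cent_dprod (gT : finGroupType) (A R : {group gT}) :
    A \subset 'N(R) -> coprime #|R| #|A| -> abelian R ->
  [~: R, A] \x 'C_R(A) = R.
Proof.
move=> nRA coRA abR; have sRAR : [~: R, A] \subset R by rewrite commg_subl.
have nRARA : A \subset 'N([~: R, A]) by rewrite commg_normr.
have nRRA : R \subset 'N([~: R, A]) by rewrite commg_norml.
have coRAA : coprime #|[~: R, A]| #|A| by apply: coprimeSg coRA.
rewrite dprodE.
- apply/eqP; rewrite eqEsubset mul_subG ?subsetIl //=.
  rewrite -quotientSK // coprime_norm_quotient_cent ?(solvableS sRAR) ?abelian_sol //.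
  by rewrite subsetI subxx quotient_cents2r.
- by rewrite (subset_trans (subsetIl _ _)) // (subset_trans abR) ?centS.
- by rewrite setIA (setIidPl sRAR) coprime_abel_cent_TI.
Qed.

(** Split R = B x T with B = [R, Q] and T = C_R(Q). Then T centralises H = BQ, and B turns out to
    have order 3, so a generator of Q inverts it. *)
Lemma index3_Sylow2_dprod (gT : finGroupType) (G R Q : {group gT}) :
    2.-group Q -> cyclic Q -> 2^'.-group R -> cyclic R -> R <| G -> R * Q = G ->
    #|G : 'N_G(Q)| = 3 ->
  exists (H T : {group gT}) (m : nat),
       [/\ (1 <= m)%N, H \x T = G, cyclic T, coprime #|T| 6 &
           H \isog Grp (a : b : (a ^+ (2 ^ m) = 1, b ^+ 3 = 1, b ^ a = b^-1))].
Proof.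
move=> pQ cycQ p'R cycR nsRG defG iN3.
have sQG : Q \subset G by rewrite -defG mulG_subr.
have nRQ : Q \subset 'N(R) := subset_trans sQG (normal_norm nsRG).
have coRQ : coprime #|R| #|Q| by rewrite coprime_sym; apply: pnat_coprime pQ p'R.
have abR := cyclic_abelian cycR.
have defR := coprime_abelian_cent_dprod nRQ coRQ abR.
set B := [~: R, Q]%G in defR; set T := 'C_R(Q)%G in defR.
have sBR : B \subset R by rewrite commg_subl.
have sTR : T \subset R by apply: subsetIl.
(* G = R N_G(Q), and R meets N_G(Q) in C_R(Q) = T by coprimality, so 3 = |G : N_G(Q)| = |R : T| =
   |B|. *)
have oB : #|B| = 3.
  have sNG : 'N_G(Q) \subset G by apply: subsetIl.
  have defRN : R * 'N_G(Q) = G.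
    apply/eqP; rewrite eqEsubset mul_subG ?(normal_sub nsRG) //=.
    by rewrite -{1}defG mulgS // subsetI sQG normG.
  have := mul_cardG R 'N_G(Q); rewrite defRN setIA (setIidPl (normal_sub nsRG)).
  rewrite (coprime_norm_cent nRQ coRQ) -(Lagrange sNG) iN3 -(dprod_card defR) /= -/T.
  have := cardG_gt0 'N_G(Q); have := cardG_gt0 T; rewrite /B /=.
  move: #|_| #|_| #|_| => t n b t_gt0 n_gt0 eq_b.
  by apply/eqP; rewrite -(eqn_pmul2r t_gt0) -(eqn_pmul2r n_gt0); apply/eqP; nia.
have cycB := cyclicS sBR cycR; have cycT := cyclicS sTR cycR.
have /cyclicP[y defB] := cycB; have /cyclicP[x defQ] := cycQ.
have coBT : coprime #|B| #|T| by rewrite -(cyclic_dprod defR).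
have [m oQ] := p_natP pQ.
have cTQ : Q \subset 'C(T) by rewrite centsC subsetIr.
have cTB : B \subset 'C(T) by have [_ _ ] := dprodP defR; rewrite centsC.
have nBQ : Q \subset 'N(B) by rewrite commg_normr.
have coBQ : coprime #|B| #|Q| := coprimeSg sBR coRQ.
pose H := (B <*> Q)%G; have defH : H :=: B * Q by rewrite /H /= norm_joinEr.
have oH : #|H| = (2 ^ m * 3)%N by rewrite defH coprime_cardMg // oB oQ mulnC.
have coT6 : coprime #|T| 6.
  rewrite (@coprimeMr _ 2 3) -oB [coprime _ #|B|]coprime_sym coBT andbT.
  by rewrite coprime_sym prime_coprime // -p'natE //; apply: pgroupS sTR p'R.
have m_gt0 : (0 < m)%N.
  case: m oQ {oH} => // /eqP; rewrite -trivg_card1 => /eqP Q1.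
  by move: iN3; rewrite Q1 norm1 setIT indexgg.
have oy : #[y] = 3 by rewrite orderE -defB.
have y3 : y ^+ 3 = 1 by rewrite -oy expg_order.
have yx : y ^ x = y^-1.
  have : y ^ x \in <[y]>.
    rewrite -defB memJ_norm; first by rewrite defB cycle_id.
    by rewrite (subsetP nBQ) // defQ cycle_id.
  (* y^x is 1, y or y^2: the first kills y, the second puts y in C_B(Q) = 1. *)
  case/cyclePmin=> [[|[|[|i]]]]; rewrite oy // => _ yx.
  - move/eqP: yx; rewrite expg0 conjg_eq1 => /eqP y1.
    by rewrite y1 order1 in oy.
  - have : y \in 'C_B(Q).
      rewrite inE {1}defB cycle_id defQ cent_cycle; apply/cent1P.
      by apply/commgP/conjg_fixP; rewrite yx expg1.
    rewrite coprime_abel_cent_TI // => /set1P y1.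
    by rewrite y1 order1 in oy.
  by rewrite yx; apply/eqP; rewrite eq_sym eq_invg_mul -expgS y3.
exists H, T, m; split=> //.
  rewrite dprodE; last first.
  - apply: coprime_TIg; rewrite oH coprime_sym.
    move: coT6; rewrite (@coprimeMr _ 2 3) => /andP[coT2 coT3].
    by rewrite coprimeMr coprimeXr.
  - by rewrite centsC /H /= join_subG cTQ cTB.
  rewrite defH -mulgA [Q * T](centC _) // mulgA.
  by have [_ -> _ _] := dprodP defR.
apply: (@Grp_ext_dihedral3 _ _ H x y); rewrite ?y3 //.
  by rewrite -defQ -defB joingC.
by rewrite -oQ defQ expg_order.
Qed.

(** * q-groups with a cyclic subgroup of index q *)

Lemma Grp_dprod_cycles n p (gT : finGroupType) (H : {group gT}) x y :
    (1 < n)%N -> (1 < p)%N -> #|H| = (n * p)%N -> <[x]> <*> <[y]> = H ->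
    x ^+ n = 1 -> y ^+ p = 1 -> [~ x, y] = 1 ->
  H \isog Grp (a : b : (a ^+ n = 1, b ^+ p = 1, [~ a, b] = 1)).
Proof.
move=> n_gt1 p_gt1 oH defH xn yp cxy.
(* Action exponent 1 makes the semidirect product model a direct product of two cyclic groups. *)
have isoE : [set: Extremal.gtype n p 1]
    \isog Grp (a : b : (a ^+ n, b ^+ p, a ^ b = a ^+ 1)).
  apply: Extremal.Grp => //; exists 1; split; rewrite ?group1 ?order1 ?dvd1n //.
  by rewrite perm1 expg1.
have isoE' : [set: Extremal.gtype n p 1]
    \isog Grp (a : b : (a ^+ n = 1, b ^+ p = 1, [~ a, b] = 1)).
  move=> rT K; rewrite isoE; apply: eq_existsb => -[a b] /=.
  rewrite !xpair_eqE; congr [&& _, _, _ & _].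
  by rewrite expg1; apply/eqP/conjg_fixP.
apply: isoGrp_trans (isoE'); apply/(isoGrpP _ isoE'); split.
  by rewrite oH Extremal.card // mulnC.
by apply/existsP; exists (x, y); rewrite /= defH xn yp cxy.
Qed.

(** All elements outside X are solutions; the inequality is strict because 1 is one more, inside
    X. *)
Lemma card_Ldiv_gt (gT : finGroupType) (G X : {group gT}) n :
    X \subset G -> {in G :\: X, forall z, #[z] = n} ->
  (#|G| - #|X| < #|'Ldiv_n(G)|)%N.
Proof.
move=> sXG oX'; have -> : (#|G| - #|X| = #|G :\: X|)%N.
  by rewrite cardsD (setIidPr sXG).
apply: proper_card; apply/properP; split.
  apply/subsetP=> z X'z; have /setDP[Gz _] := X'z.
  by rewrite !inE Gz -order_dvdn oX' ?dvdnn.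
by exists 1; rewrite !inE group1 ?expg1n ?eqxx.
Qed.

(** The 2^(n-1) >= 4 elements outside the cyclic maximal subgroup are involutions. *)
Lemma dihedral_card_Ldiv2 (gT : finGroupType) (G : {group gT}) n :
  (2 < n)%N -> G \isog 'D_(2 ^ n) -> (4 < #|'Ldiv_2(G)|)%N.
Proof.
move=> n_gt2 isoG; have n_gt1 := ltnW n_gt2.
have [[x y] genG _] := generators_2dihedral n_gt1 isoG.
have [[_ oX' _] _ _ _ _] := dihedral2_structure n_gt1 genG isoG.
have [oG Gx ox _] := genG.
have := @card_Ldiv_gt _ G <[x]>%G 2; rewrite cycle_subG => /(_ Gx oX').
apply: leq_trans; rewrite oG -orderE ox -(subnKC n_gt2) /= !expnS.
have := expn_gt0 2 (n - 3); lia.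
Qed.

Lemma quaternion_card_Ldiv4 (gT : finGroupType) (G : {group gT}) n :
  (3 < n)%N -> G \isog 'Q_(2 ^ n) -> (8 < #|'Ldiv_4(G)|)%N.
Proof.
move=> n_gt3 isoG; have n_gt2 := ltnW n_gt3.
have [[x y] genG _] := generators_quaternion n_gt2 isoG.
have [[_ oX' _] _ _ _ _] := quaternion_structure n_gt2 genG isoG.
have [oG Gx ox _] := genG.
have := @card_Ldiv_gt _ G <[x]>%G 4; rewrite cycle_subG => /(_ Gx oX').
apply: leq_trans; rewrite oG -orderE ox -(subnKC n_gt3) /= !expnS.
have := expn_gt0 2 (n - 4); lia.
Qed.

(** The normal closure of y is dihedral of order 2^(n-1) >= 8 and already has too many
    involutions. *)
Lemma semidihedral_card_Ldiv2 (gT : finGroupType) (G : {group gT}) n :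
  (3 < n)%N -> G \isog 'SD_(2 ^ n) -> (4 < #|'Ldiv_2(G)|)%N.
Proof.
move=> n_gt3 isoG.
have [[x y] genG [oy _]] := generators_semidihedral n_gt3 isoG.
have [_ _ _ _ [isoMy _ _]] := semidihedral_structure n_gt3 genG isoG oy.
have [_ _ _ /setDP[Gy _]] := genG.
have n1_gt2 : (2 < n.-1)%N by rewrite -ltnS prednK // (ltn_trans _ n_gt3).
apply: leq_trans (dihedral_card_Ldiv2 n1_gt2 isoMy) _; apply: subset_leq_card; apply: setSI.
by rewrite gen_subG class_subG.
Qed.

Lemma cyclic_index_p_small_Ldiv (gT : finGroupType) (Q : {group gT}) q x :
    prime q -> q.-group Q -> x \in Q -> #[x] = exponent Q -> #|Q| = (q * #[x])%N ->
    (forall k, q ^ k %| exponent Q -> #|'Ldiv_(q ^ k)(Q)| <= q * q ^ k)%N ->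
  (exists m, (2 <= m)%N /\
     Q \isog Grp (a : b : (a ^+ (q ^ m.-1) = 1, b ^+ q = 1, [~ a, b] = 1))) \/
  (Q \isog Grp (a : b : (a ^+ 4 = 1, b ^+ 2 = a ^+ 2, a ^ b = a^-1))) \/
  (q = 2 /\ exists m, (4 <= m)%N /\
     Q \isog Grp (a : b : (a ^+ (2 ^ m.-1) = 1, b ^+ 2 = 1,
                           a ^ b = a ^+ (1 + 2 ^ (m - 2))))) \/
  ((2 < q)%N /\ exists m, (3 <= m)%N /\
     Q \isog Grp (a : b : (a ^+ (q ^ m.-1) = 1, b ^+ q = 1,
                           a ^ b = a ^+ (1 + q ^ (m - 2))))).
Proof.
move=> q_pr qQ Qx ox oQ Ldiv_le; have q_gt1 := prime_gt1 q_pr.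
have /p_natP[e def_e] : q.-nat #[x] by apply: mem_p_elt qQ Qx.
have e_gt0 : (0 < e)%N.
  rewrite lt0n; apply: contraL q_gt1 => /eqP e0; rewrite e0 expn0 in def_e.
  have /trivgP Q1 : Q \subset [1].
    apply/subsetP=> z Qz; have := expg_exponent Qz.
    by rewrite -ox def_e expg1 => ->; rewrite set11.
  by move/eqP: oQ; rewrite Q1 cards1 def_e muln1 => /eqP <-.
have sxQ : <[x]> \subset Q by rewrite cycle_subG.
have [abQ | nabQ] := boolP (abelian Q).
  left; exists e.+1; split=> //.
  (* In an abelian q-group a cyclic subgroup of maximal order has a complement, here of order q. *)
  have /splitsP[K /complP[tixK defQ]] := abelian_splits Qx ox abQ.
  have oK : #|K| = q.
    apply/eqP; rewrite -(eqn_pmul2l (order_gt0 x)) [X in _ == X]mulnC -oQ.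
    by rewrite -defQ TI_cardMg.
  have /cyclicP[y defK] : cyclic K by apply: prime_cyclic; rewrite oK.
  have sKQ : K \subset Q by rewrite -defQ mulG_subr.
  have Qy : y \in Q by rewrite -cycle_subG -defK.
  apply: (@Grp_dprod_cycles _ _ _ Q x y) => //=.
  - by rewrite -{1}(expn0 q) ltn_exp2l.
  - by rewrite oQ def_e mulnC.
  - by rewrite -defK -defQ cent_joinEr // (subset_trans sKQ) // (subset_trans abQ) ?centS.
  - by rewrite -def_e expg_order.
  - by rewrite -oK defK expg_order.
  by apply/eqP/commgP; apply: (centsP abQ).
right.
have iX : #|Q : <[x]>| = q by rewrite -divgS // -orderE oQ mulnK.
have Ldiv2 : q = 2 -> (#|'Ldiv_2(Q)| <= 4)%N.
  by move=> q2; have := Ldiv_le 1%N; rewrite -ox def_e q2 dvdn_exp2l // => /(_ isT).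
(* A nonabelian q-group with a cyclic subgroup of index q is modular, or q = 2 and it is dihedral,
   semidihedral or quaternion. *)
have := @maximal_cycle_extremal _ q Q <[x]>%G qQ nabQ (cycle_cyclic x) sxQ iX.
case/orP=> [/eqP /modular_group_classP[p p_pr [n n_ge isoQ]]|/andP[/eqP q2 ext2]].
  have n_gt2 : (2 < n)%N by apply: leq_trans n_ge; rewrite leq_addl.
  have oQ' : #|Q| = (p ^ n)%N by rewrite (card_isog isoQ) card_modular_group.
  have ntQ : Q :!=: 1 by apply: contraNneq nabQ => ->; rewrite abelian1.
  have def_p : p = q.
    have [_ dv_q _] := pgroup_pdiv qQ ntQ.
    move: dv_q; rewrite oQ' Euclid_dvdX // => /andP[/(prime_nt_dvdP p_pr)-> //].
    by rewrite neq_ltn q_gt1 orbT.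
  rewrite def_p in n_ge isoQ; right.
  have isoG := isoGrp_trans isoQ (Grp_modular_group q_pr n_gt2).
  have [q2|q_odd] := even_prime q_pr; [left | right]; split=> //.
  - rewrite q2 in n_ge isoG; exists n; split=> //.
    by rewrite add1n subn2.
  - by case: (q) q_pr q_odd => [|[|[|?]]].
  by exists n; split=> //; rewrite add1n subn2.
move: ext2; rewrite /extremal2 /= !inE => /or3P[] /eqP.
- case/dihedral_classP=> n n_gt1 isoQ; have := Ldiv2 q2; rewrite leqNgt.
  rewrite (dihedral_card_Ldiv2 _ isoQ) // ltn_neqAle n_gt1 andbT.
  (* n = 2 would be the Klein four-group, which is abelian. *)
  apply: contraNneq nabQ => n2; apply: (p2group_abelian qQ).
  by rewrite (card_isog isoQ) card_2dihedral // -n2 q2.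
- case/semidihedral_classP=> n n_gt3 isoQ; have := Ldiv2 q2.
  by rewrite leqNgt (semidihedral_card_Ldiv2 _ isoQ).
case/quaternion_classP=> n n_gt2 isoQ; left.
have [n3 | n_gt3] : n = 3 \/ (3 < n)%N by lia.
  by rewrite n3 in isoQ; apply: isoGrp_trans isoQ (@Grp_quaternion 3 isT).
have oQ' : #|Q| = (2 ^ n)%N by rewrite (card_isog isoQ) card_quaternion.
have := quaternion_card_Ldiv4 n_gt3 isoQ; rewrite ltnNge.
have := Ldiv_le 2; rewrite -ox def_e q2 dvdn_exp2l //; first by move=> /(_ isT) ->.
(* The bound for x^4 = 1 is available since the exponent 2^(n-1) is divisible by 4. *)
by rewrite -ltnS; have /expnI-> // : (2 ^ e.+1 = 2 ^ n)%N by rewrite -oQ' oQ def_e q2 expnS.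
Qed.

(** * Direct products and upper bounds for solution counts *)

Lemma Grp_cycle n (gT : finGroupType) (x : gT) :
  #[x] = n -> <[x]> \isog Grp (a : a ^+ n).
Proof.
move=> ox; apply: intro_isoGrp => [|rT K].
  by apply/existsP; exists x; rewrite /= -ox expg_order.
case/existsP=> a /= /eqP[<- an].
have dv_a : #[a] %| #[x] by rewrite ox order_dvdn an.
by apply/homgP; exists (eltm_morphism dv_a); rewrite /= im_eltm.
Qed.

Lemma dprod_normal_Hall (gT : finGroupType) (G H K : {group gT}) (pi : nat_pred) :
  pi.-Hall(G) H -> H <| G -> pi^'.-Hall(G) K -> K <| G -> H \x K = G.
Proof.
move=> hallH nsHG hallK nsKG.
have coHK : coprime #|H| #|K|.
  exact: pnat_coprime (pHall_pgroup hallH) (pHall_pgroup hallK).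
rewrite dprodE ?coprime_TIg //.
  apply/eqP; rewrite eqEcard mul_subG ?(normal_sub nsHG) ?(normal_sub nsKG) //=.
  by rewrite coprime_cardMg // (card_Hall hallH) (card_Hall hallK) partnC ?leqnn.
rewrite (sameP commG1P trivgP) -(coprime_TIg coHK) setIC commg_subI //.
  by rewrite subsetI subxx (subset_trans (normal_sub nsKG)) // normal_norm.
by rewrite subsetI subxx (subset_trans (normal_sub nsHG)) // normal_norm.
Qed.

(** If g = h t solves g^n = 1, then t^n lies in both factors, so t^n = 1 and coprimality gives t =
    1. *)
Lemma Ldiv_dprod (gT : finGroupType) (G H T : {group gT}) n :
  H \x T = G -> coprime n #|T| -> 'Ldiv_n(G) \subset 'Ldiv_n(H).
Proof.
move=> defG con; apply/subsetP=> g /LdivP[Gg gn].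
have [h [t [Hh Tt def_g _]]] := mem_dprod defG Gg.
have [_ _ cHT tiHT] := dprodP defG.
have cht : commute h t by apply/commute_sym/(centsP cHT).
have : h ^+ n * t ^+ n = 1 by rewrite -expgMn // -def_g.
move/eqP; rewrite -eq_invg_mul => /eqP def_tn.
have : t ^+ n \in H :&: T by rewrite inE -{1}def_tn groupV !groupX.
rewrite tiHT => /set1P tn1.
suff t1 : t = 1 by apply/LdivP; split=> //; rewrite def_g t1 mulg1.
apply/eqP; rewrite -order_eq1 -dvdn1 -(eqP con) dvdn_gcd order_dvdn tn1 eqxx.
exact: order_dvdG.
Qed.

(** The solutions form a cyclic subgroup, whose order equals its exponent, a divisor of n. *)
Lemma cyclic_card_Ldiv (gT : finGroupType) (C : {group gT}) n :
  cyclic C -> (0 < n)%N -> (#|'Ldiv_n(C)| <= n)%N.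
Proof.
move=> cycC n_gt0; have abC := cyclic_abelian cycC.
pose L := group (group_Ldiv n abC).
have cycL : cyclic L by apply: cyclicS cycC; apply: subsetIl.
by rewrite -[#|_|](exponent_cyclic cycL) dvdn_leq // -sub_LdivT subsetIr.
Qed.

Lemma leq_card_mulg (gT : finGroupType) (A B : {set gT}) :
  (#|(A * B)%g| <= #|A| * #|B|)%N.
Proof. by rewrite -cardsX [(A * B)%g]curry_imset2X leq_imset_card. Qed.

(** Since p divides n, every power of y is a solution; so the solutions are covered by <y> times
    those in <x>. *)
Lemma abelian_card_Ldiv (gT : finGroupType) (Q : {group gT}) x y p n :
    abelian Q -> <[x]> <*> <[y]> = Q -> (0 < p)%N -> (0 < n)%N -> p %| n -> y ^+ p = 1 ->
  (#|'Ldiv_n(Q)| <= p * n)%N.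
Proof.
move=> abQ defQ p_gt0 n_gt0 dv_pn yp.
have cxy : <[y]> \subset 'C(<[x]>).
  rewrite (subset_trans _ (centS (joing_subl <[x]> <[y]>))) // defQ.
  by rewrite (subset_trans _ abQ) // -defQ joing_subr.
rewrite cent_joinEr // in defQ.
have sL : 'Ldiv_n(Q) \subset <[y]> * 'Ldiv_n(<[x]>).
  apply/subsetP=> g /LdivP[]; rewrite -defQ -(centC cxy) => /mulsgP[v u yv xu ->].
  have /dvdnP[c ->] := dv_pn.
  have /cycleP[j ->] := yv.
  rewrite expgMn; last by apply: (centsP cxy); rewrite ?mem_cycle.
  rewrite {1}mulnC expgM [_ ^+ j ^+ p]expgAC yp !expg1n mul1g => un.
  by rewrite mem_mulg ?mem_cycle //; apply/LdivP.
apply: leq_trans (subset_leq_card sL) _; apply: leq_trans (leq_card_mulg _ _) _.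
by rewrite leq_mul ?cyclic_card_Ldiv ?cycle_cyclic // dvdn_leq // -/#[y] order_dvdn yp.
Qed.

(** For k < n - 1 the solutions lie in ['Ohm_k(Q)], of order p^(k+1); for larger k the order p^n of
    Q is small enough. *)
Lemma modular_card_Ldiv (gT : finGroupType) (Q : {group gT}) p n k :
    prime p -> (2 < n)%N -> (p, n) != (2, 3) -> Q \isog 'Mod_(p ^ n) -> (0 < k)%N ->
  (#|'Ldiv_(p ^ k)(Q)| <= p * p ^ k)%N.
Proof.
move=> p_pr n_gt2 pn_neq isoQ k_gt0.
have [[x y] genQ modQ] := generators_modular_group p_pr n_gt2 isoQ.
have [oQ _ _ _] := genQ.
have [_ _ _ _] := modular_group_structure p_pr n_gt2 genQ isoQ modQ.
rewrite (negPf pn_neq) => defOhm; rewrite -expnS.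
have [k_lt | k_ge] := ltnP k n.-1; last first.
  apply: leq_trans (subset_leq_card (subsetIl _ _)) _.
  by rewrite oQ leq_exp2l ?prime_gt1 // -(ltn_predK n_gt2).
have [|_ <-] := defOhm k; first by rewrite k_gt0.
have pQ : p.-group Q by rewrite /pgroup oQ pnatX pnat_id.
by rewrite (OhmE _ pQ) subset_leq_card // subset_gen.
Qed.

(** For k = 1 the only involution is x^2; for k >= 2 the bound is at least |Q| = 8. *)
Lemma quaternion8_card_Ldiv (gT : finGroupType) (Q : {group gT}) k :
  Q \isog 'Q_8 -> (0 < k)%N -> (#|'Ldiv_(2 ^ k)(Q)| <= 2 * 2 ^ k)%N.
Proof.
move=> isoQ; have oQ : #|Q| = 8 by rewrite (card_isog isoQ) (@card_quaternion 3).
case: k => [|[|k]] // _; last first.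
  apply: leq_trans (subset_leq_card (subsetIl _ _)) _.
  by rewrite oQ -expnS (@leq_exp2l 2 3).
have [[x y] genQ _] := @generators_quaternion _ _ 3 isT isoQ.
have [_ _ [_ _ inv _ _] _ _] := @quaternion_structure _ _ 3 _ _ isT genQ isoQ.
have sL : 'Ldiv_2(Q) \subset [set 1; x ^+ 2].
  apply/subsetP=> u /LdivP[Qu u2]; rewrite !inE.
  case: eqVneq => //= nt_u; rewrite (inv u Qu) //.
  exact: nt_prime_order.
by apply: leq_trans (subset_leq_card sL) _; rewrite cards2; case: eqP.
Qed.

(** This is the congruence (v u)^n = u^n modulo Y. *)
Lemma expg_mul_norm (gT : finGroupType) (Y : {group gT}) u v n :
  u \in 'N(Y) -> v \in Y -> exists2 w, w \in Y & (v * u) ^+ n = w * u ^+ n.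
Proof.
move=> nYu Yv; elim: n => [|n [w Yw IHn]]; first by exists 1; rewrite ?mulg1.
exists (w * (v ^ u ^- n)).
  by rewrite groupM // memJ_norm // groupV groupX.
by rewrite expgSr IHn [u ^+ n.+1]expgSr /conjg invgK !mulgA mulgKV.
Qed.

(** * Solution counts when x, of 2-power order, inverts y with y^3 = 1 *)

Section ExtDihedral3.

Variables (gT : finGroupType) (H : {group gT}) (x y : gT) (m : nat).
Hypotheses (defH : <[x]> <*> <[y]> = H) (xm : x ^+ (2 ^ m) = 1).
Hypotheses (y3 : y ^+ 3 = 1) (yx : y ^ x = y^-1).

Let nyx : <[x]> \subset 'N(<[y]>).
Proof. by rewrite norms_cycle yx groupV cycle_id. Qed.

Let defYX : <[y]> * <[x]> = H.
Proof. by rewrite -defH joingC norm_joinEr. Qed.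

Let coYX : coprime #[y] #[x].
Proof.
apply: (@coprime_dvdl _ 3); first by rewrite order_dvdn y3.
apply: (@coprime_dvdr _ (2 ^ m)); first by rewrite order_dvdn xm.
by rewrite coprimeXr.
Qed.

(** Modulo <y> the equation reads u^n = 1, so u^n lies in the intersection of <y> and <x>, trivial
    by coprimality. *)
Let Ldiv_factor n g : g \in 'Ldiv_n(H) ->
  exists v u, [/\ v \in <[y]>, u \in 'Ldiv_n(<[x]>) & g = v * u].
Proof.
case/LdivP; rewrite -defYX => /mulsgP[v u Yv Xu ->] gn; exists v, u; split=> //.
have [w Yw def_gn] := expg_mul_norm n (subsetP nyx u Xu) Yv.
have : u ^+ n \in <[y]> :&: <[x]>.
  by rewrite inE [X in _ && X]groupX // andbT -(groupMl _ Yw) -def_gn gn group1.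
by rewrite (coprime_TIg coYX) => /set1P un; apply/LdivP.
Qed.

Lemma ext_dihedral3_card_dvd : #|H| %| 2 ^ m * 3.
Proof.
rewrite -defYX (coprime_cardMg coYX) mulnC dvdn_mul //.
  by rewrite -/#[x] order_dvdn xm.
by rewrite -/#[y] order_dvdn y3.
Qed.

(** The solutions lie in <y> times those of <x>, a set of at most 3 * 2^k elements. If y has order 3
    it belongs to this set without being a solution, which gives strictness. *)
Lemma ext_dihedral3_Ldiv2 k : (#|'Ldiv_(2 ^ k)(H)| < 3 * 2 ^ k)%N.
Proof.
have k_gt0 : (0 < 2 ^ k)%N by rewrite expn_gt0.
have le_Lx := cyclic_card_Ldiv (cycle_cyclic x) k_gt0.
have sL : 'Ldiv_(2 ^ k)(H) \subset <[y]> * 'Ldiv_(2 ^ k)(<[x]>).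
  by apply/subsetP=> g /Ldiv_factor[v [u [Yv Lu ->]]]; apply: mem_mulg.
have [y1 | nt_y] := eqVneq y 1.
  apply: leq_ltn_trans (subset_leq_card sL) _.
  rewrite y1 cycle1 mul1g (leq_ltn_trans le_Lx) //; lia.
have oy : #[y] = 3 by apply: nt_prime_order.
apply: (@leq_trans #|<[y]> * 'Ldiv_(2 ^ k)(<[x]>)|%g); last first.
  by apply: leq_trans (leq_card_mulg _ _) _; rewrite -orderE oy leq_mul2l.
apply: proper_card; apply/properP; split=> //; exists y.
  by apply/mulsgP; exists y 1; rewrite ?cycle_id ?mulg1 // !inE group1 expg1n /=.
by rewrite !inE -order_dvdn oy (@Euclid_dvdX 2 k 3) // andbF.
Qed.

Lemma ext_dihedral3_Ldiv3 k : (#|'Ldiv_(3 ^ k)(H)| <= 3 ^ k)%N.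
Proof.
case: k => [|k]; first by rewrite Ldiv1 cards1.
have sL : 'Ldiv_(3 ^ k.+1)(H) \subset <[y]>.
  apply/subsetP=> g /Ldiv_factor[v [u [Yv /LdivP[Xu un] ->]]].
  suff -> : u = 1 by rewrite mulg1.
  apply/eqP; rewrite -order_eq1 -dvdn1.
  have /eqP<- : coprime (3 ^ k.+1) (2 ^ m) by rewrite coprimeXl ?coprimeXr.
  rewrite dvdn_gcd order_dvdn un eqxx.
  by apply: dvdn_trans (order_dvdG Xu) _; rewrite order_dvdn xm.
apply: leq_trans (subset_leq_card sL) _.
apply: (@leq_trans 3); last by rewrite expnS leq_pmulr // expn_gt0.
by apply: dvdn_leq => //; rewrite -/#[y] order_dvdn y3.
Qed.

End ExtDihedral3.

(** By Frobenius the count is a multiple of n, so the strict bound drops to the next multiple. *)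
Lemma dvd_exponent_card_Ldiv (gT : finGroupType) (G : {group gT}) n f :
  n %| exponent G -> (#|'Ldiv_n(G)| < f.+1 * n)%N -> (#|'Ldiv_n(G)| <= f * n)%N.
Proof.
move=> dv_n; have /dvdnP[c ->] := Frobenius_Ldiv (dvdn_exponent_card dv_n).
have [->|n_gt0] := posnP n; first by rewrite !muln0.
by rewrite ltn_pmul2r // leq_pmul2r.
Qed.

(** * The classification, in both directions *)

Theorem theorem1p1 (gT : finGroupType) (G Q : {group gT}) :
  (1 < #|G|)%N ->
  Q \in 'Syl_(pdiv #|G|)(G) ->
  let q := pdiv #|G| in
  (mf_pp G <= q)%N <->
  ((exists R : {group gT},
       [/\ q^'.-Hall(G) R, cyclic R, Q \x R = G &
        (exists m, (1 <= m)%N /\ Q \isog Grp (a : a ^+ (q ^ m))) \/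
            (exists m, (2 <= m)%N /\
              Q \isog Grp (a : b : (a ^+ (q ^ m.-1) = 1, b ^+ q = 1, [~ a, b] = 1))) \/
            (Q \isog Grp (a : b : (a ^+ 4 = 1, b ^+ 2 = a ^+ 2, a ^ b = a^-1))) \/
            (q = 2 /\ exists m, (4 <= m)%N /\
              Q \isog Grp (a : b : (a ^+ (2 ^ m.-1) = 1, b ^+ 2 = 1,
                                    a ^ b = a ^+ (1 + 2 ^ (m - 2)))))
          \/ ((2 < q)%N /\ exists m, (3 <= m)%N /\
              Q \isog Grp (a : b : (a ^+ (q ^ m.-1) = 1, b ^+ q = 1,
                                    a ^ b = a ^+ (1 + q ^ (m - 2)))))])
   \/
   (exists (H T : {group gT}) (m : nat),
       [/\ (1 <= m)%N, H \x T = G, cyclic T, coprime #|T| 6 &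
           H \isog Grp (a : b : (a ^+ (2 ^ m) = 1, b ^+ 3 = 1, b ^ a = b^-1))])).
Proof.
move=> G_gt1; rewrite inE => sylQ q.
have q_pr : prime q := pdiv_prime G_gt1; have q_gt1 := prime_gt1 q_pr.
have [sQG qQ _] := and3P sylQ; rewrite -/q in sylQ qQ.
rewrite mf_pp_leP; split=> [Ldiv_lt | ].
  have sylG (p : nat) (P : {group gT}) :
      prime p -> p \in q^' -> p.-Sylow(G) P -> cyclic P /\ P <| G.
    move=> p_pr q'p sylP; have [dv_p | ndv_p] := boolP (p %| #|G|).
      (* Since q is the least prime divisor, q + 1 <= p, so the bound falls below p * p^k. *)
      apply: (cyclic_normal_Sylow p_pr _ sylP) => k dv_pk.
      apply: leq_trans (Ldiv_lt p k p_pr dv_pk) _; apply: leq_mul => //.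
      by rewrite ltn_neqAle pdiv_min_dvd ?prime_gt1 // andbT eq_sym.
    suff -> : P :=: 1 by rewrite cyclic1 normal1.
    by apply/eqP; rewrite trivg_card1 (card_Hall sylP) part_p'nat // p'natE.
  have [R [hallR cycR nsRG]] := cyclic_normal_Hall sylG.
  have Ldiv_le k : q ^ k %| exponent G -> (#|'Ldiv_(q ^ k)(G)| <= q * q ^ k)%N.
    by move=> dv_k; apply: dvd_exponent_card_Ldiv => //; apply: Ldiv_lt.
  have [x [e Qx [ox expQ]]] := pgroup_exponent_witness qQ.
  have dv_e : q ^ e %| exponent G by rewrite -expQ exponentS.
  have sxQ : <[x]> \subset Q by rewrite cycle_subG.
  have [n oQ] := p_natP qQ.
  have n_ge : (e <= n)%N.
    by rewrite -(leq_exp2l _ _ q_gt1) -oQ -ox subset_leq_card.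
  (* All of Q solves x^(q^e) = 1, which has at most q^(e+1) solutions. *)
  have n_le : (n <= e.+1)%N.
    rewrite -(leq_exp2l _ _ q_gt1) -oQ expnS (leq_trans _ (Ldiv_le e dv_e)) //.
    by rewrite subset_leq_card // subsetI sQG sub_LdivT expQ dvdnn.
  have [n_gt | n_le_e] := ltnP e n.
    have def_n : n = e.+1 by apply/eqP; rewrite eqn_leq n_le.
    have [||_ nsQG] := @normal_of_card_Ldiv _ G Q (q ^ e) sQG.
    - by rewrite expQ dvdnn.
    - by rewrite oQ def_n expnS; apply: Ldiv_le.
    left; exists R; split=> //; first exact: dprod_normal_Hall sylQ nsQG hallR nsRG.
    right; apply: (@cyclic_index_p_small_Ldiv _ Q q x) => //.
    - by rewrite ox expQ.
    - by rewrite oQ ox def_n expnS.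
    move=> k dv_k; apply: leq_trans (Ldiv_le k _); last first.
      exact: dvdn_trans dv_k (exponentS sQG).
    by rewrite subset_leq_card // setSI.
  have defQ : Q :=: <[x]>.
    by apply/eqP; rewrite eq_sym eqEcard sxQ -orderE oQ ox leq_exp2l.
  have cycQ : cyclic Q by rewrite defQ cycle_cyclic.
  have oQe : #|Q| = (q ^ e)%N by rewrite -ox orderE -defQ.
  have [nsQG | nnQ] := boolP (Q <| G).
    left; exists R; split=> //; first exact: dprod_normal_Hall sylQ nsQG hallR nsRG.
    left; exists e; split; last by rewrite defQ; apply: Grp_cycle.
    rewrite -(pfactorK e q_pr) -oQe (card_Hall sylQ) p_part pfactorK //.
    by rewrite logn_gt0 mem_primes q_pr cardG_gt0 pdiv_dvd.
  have [|q2 iN] := nonnormal_cyclic_Sylow G_gt1 sylQ cycQ _ nnQ.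
    by rewrite -/q oQe Ldiv_le.
  right; rewrite -/q in q2; rewrite q2 in qQ hallR.
  apply: (@index3_Sylow2_dprod _ G R Q) => //; first exact: pHall_pgroup hallR.
  apply/eqP; rewrite eqEcard mul_subG ?(normal_sub nsRG) //=.
  rewrite coprime_cardMg; last first.
    rewrite coprime_sym; exact: pnat_coprime qQ (pHall_pgroup hallR).
  by rewrite (card_Hall hallR) (card_Hall sylQ) q2 mulnC partnC ?leqnn.
move=> casesG p k p_pr _; have pk_gt0 : (0 < p ^ k)%N by rewrite expn_gt0 prime_gt0.
case: casesG => [[R [hallR cycR defG casesQ]] | [H [T [m [m_gt0 defG cycT coT6 isoH]]]]].
  suff le_L : (#|'Ldiv_(p ^ k)(G)| <= q * p ^ k)%N.
    by rewrite (leq_ltn_trans le_L) // ltn_pmul2r.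
  have [eq_pq | neq_pq] := eqVneq p q; last first.
    have coQ : coprime (p ^ k) #|Q|.
      rewrite coprimeXl // prime_coprime // -p'natE //.
      by apply: pi_p'nat qQ _; rewrite !inE.
    have sL : 'Ldiv_(p ^ k)(G) \subset 'Ldiv_(p ^ k)(R).
      by apply: Ldiv_dprod coQ; rewrite dprodC.
    apply: leq_trans (subset_leq_card sL) _.
    by rewrite (leq_trans (cyclic_card_Ldiv cycR pk_gt0)) // leq_pmull // ltnW.
  have coR : coprime (q ^ k) #|R|.
    by apply: pnat_coprime (pHall_pgroup hallR); rewrite pnatX pnat_id.
  rewrite eq_pq in pk_gt0 *.
  apply: leq_trans (subset_leq_card (Ldiv_dprod defG coR)) _.
  (* From here on p = q and only Q contributes; k = 0 is split off because the bounds for modular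
     and quaternion groups start at k = 1. *)
  have [->|k_gt0] := posnP k; first by rewrite Ldiv1 cards1 muln1 ltnW.
  case: casesQ => [[m [_ /isoGrp_hom/existsP[a /= /eqP[defQ _]]]]|].
    rewrite (leq_trans (cyclic_card_Ldiv _ pk_gt0)) ?leq_pmull ?(ltnW q_gt1) //.
    by rewrite -defQ cycle_cyclic.
  case=> [[m [_ /isoGrp_hom/existsP[[a b] /= /eqP[defQ _ bq cab]]]]|].
    apply: (@abelian_card_Ldiv _ Q a b) => //; rewrite ?dvdn_exp // ?(ltnW q_gt1) //.
    rewrite -defQ abelianY !cycle_abelian cent_cycle cycle_subG cent1C.
    by apply/cent1P/commgP/eqP.
  case=> [isoQ|].
    have isoQ8 : Q \isog 'Q_8.
      have isoQ8 := @Grp_quaternion 3 isT.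
      by rewrite isogEhom isoQ8 isoGrp_hom //= isoQ (isoGrp_hom isoQ8).
    have q2 : q = 2.
      have [Q1 | ntQ] := eqVneq Q 1%G.
        by have := card_isog isoQ8; rewrite (@card_quaternion 3) // Q1 cards1.
      have [_ dv_q _] := pgroup_pdiv qQ ntQ.
      move: dv_q; rewrite (card_isog isoQ8) (@card_quaternion 3) //.
      by rewrite (@Euclid_dvdX 2 3) // andbT dvdn_prime2 // => /eqP.
    by rewrite q2; apply: quaternion8_card_Ldiv.
  have modQ m : (2 < m)%N -> (q, m) != (2, 3) ->
     Q \isog Grp (a : b : (a ^+ (q ^ m.-1) = 1, b ^+ q = 1,
                           a ^ b = a ^+ (1 + q ^ (m - 2)))) ->
     (#|'Ldiv_(q ^ k)(Q)| <= q * q ^ k)%N.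
    rewrite add1n subn2 => m_gt2 qm_neq isoQ.
    apply: (@modular_card_Ldiv _ Q q m) => //.
    have isoM := Grp_modular_group q_pr m_gt2.
    by rewrite isogEhom isoM isoGrp_hom //= isoQ (isoGrp_hom isoM).
  case=> [[q2 [m [m_gt3 isoQ]]]|[q_gt2 [m [m_gt2 isoQ]]]]; apply: (modQ m) => //.
  - exact: ltnW.
  - by rewrite xpair_eqE negb_and orbC neq_ltn m_gt3 orbT.
  - by rewrite q2.
  by rewrite xpair_eqE negb_and neq_ltn q_gt2 orbT.
have /existsP[[x y] /= /eqP[defH xm y3 yx]] := isoGrp_hom isoH.
have dvH := ext_dihedral3_card_dvd defH xm y3 yx.
(* As q >= 2, fewer than 3 p^k solutions suffice. They lie in H when p divides 6 and in T
   otherwise. *)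
have three_le : (3 * p ^ k <= q.+1 * p ^ k)%N by rewrite leq_mul2r ltnS q_gt1 orbT.
have [dv_p6 | ndv_p6] := boolP (p %| 6).
  have coT : coprime (p ^ k) #|T|.
    by rewrite coprimeXl // (coprime_dvdl dv_p6) // coprime_sym.
  apply: leq_trans three_le.
  apply: leq_ltn_trans (subset_leq_card (Ldiv_dprod defG coT)) _.
  move: dv_p6; rewrite (@Euclid_dvdM 2 3) // !dvdn_prime2 // => /orP[]/eqP->.
    exact: ext_dihedral3_Ldiv2 defH xm y3 yx k.
  apply: leq_ltn_trans (ext_dihedral3_Ldiv3 defH xm y3 yx k) _.
  by rewrite -{1}[(3 ^ k)%N]mul1n ltn_pmul2r ?expn_gt0.
have coH : coprime (p ^ k) #|H|.
  rewrite coprimeXl // prime_coprime //; apply: contra ndv_p6 => /dvdn_trans/(_ dvH).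
  rewrite Euclid_dvdM // Euclid_dvdX // (@Euclid_dvdM 2 3) //.
  by case/orP=> [/andP[->] | ->]; rewrite ?orbT.
have sL : 'Ldiv_(p ^ k)(G) \subset 'Ldiv_(p ^ k)(T).
  by apply: Ldiv_dprod coH; rewrite dprodC.
apply: leq_ltn_trans (subset_leq_card sL) _.
apply: leq_ltn_trans (cyclic_card_Ldiv cycT pk_gt0) _.
by apply: leq_trans three_le; rewrite -{1}[(p ^ k)%N]mul1n ltn_pmul2r.
Qed.
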